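(* Let $X_n=(x_{ij})_{n\times p}$, where the $x_{ij}$ are i.i.d. real random variables with mean $\mu$, variance $\sigma^2>0$ and $E e^{t_0|x_{11}|^2}<\infty$ for some $t_0>0$. Let $\tilde L_n$ be the coherence of $X_n$ (with known mean $\mu$). Let $\xi,\eta$ be random variables such that $\xi,\eta,(x_{11}-\mu)/\sigma$ are i.i.d., and define $$I_1(x)=\sup_{\theta\in\mathbb{R}}\{\theta x-\log E e^{\theta\xi\eta}\},\qquad I_2(x)=\sup_{\theta\in\mathbb{R}}\{\theta x-\log E e^{\theta\xi^2}\}.$$ Then, for any $t>0$, $$P(\tilde L_n\ge t)\le 3p^2e^{-n g(t)},\qquad\text{where } g(t)=\min\{I_1(t/2),\,I_2(1/2)\},$$ and $g(t)>0$ for any $t>0$.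
   Context: Let $x_1,\dots,x_p\in\mathbb{R}^n$ be the columns of $X_n$, $e=(1,\dots,1)^T\in\mathbb{R}^n$, and write $x_i-\mu$ for $x_i-\mu e$. With $\|\cdot\|$ the Euclidean norm, $$\tilde\rho_{ij}=\frac{(x_i-\mu)^T(x_j-\mu)}{\|x_i-\mu\|\cdot\|x_j-\mu\|},\quad 1\le i,j\le p,\qquad \tilde L_n=\max_{1\le i<j\le p}|\tilde\rho_{ij}|.$$ $I_1,I_2$ take values in $[0,+\infty]$. $\log$ is the natural logarithm. *)

(* Defs.v *)
From HB Require Import structures.
From mathcomp Require Import all_boot all_order all_algebra.
From mathcomp Require Import all_classical all_reals all_analysis.
Set Implicit Arguments.
Unset Strict Implicit.
Unset Printing Implicit Defensive.
Import Order.TTheory GRing.Theory Num.Theory.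
Import numFieldNormedType.Exports.
Local Open Scope classical_set_scope.
Local Open Scope ring_scope.

Section coherence.
Variables (R : realType) (n p : nat).

(* The library norm on matrices is the max norm, hence this definition. *)
Definition euclidean_norm (v : 'cV[R]_n) : R :=
  Num.sqrt (\sum_(k < n) v k ord0 ^+ 2).

Definition centered_col (mu : R) (A : 'M[R]_(n, p)) (i : 'I_p) : 'cV[R]_n :=
  col i A - const_mx mu.

(* If one of the two centered columns vanishes, the quotient is 0. *)
Definition rho_tilde (mu : R) (A : 'M[R]_(n, p)) (i j : 'I_p) : R :=
  ((centered_col mu A i)^T *m centered_col mu A j) ord0 ord0 /
  (euclidean_norm (centered_col mu A i) * euclidean_norm (centered_col mu A j)).

(* The terms are nonnegative, so starting the maximum at 0 only matters when
   there is no pair i < j, where the maximum is 0. *)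
Definition coherence_known_mean (mu : R) (A : 'M[R]_(n, p)) : R :=
  \big[Num.max/0]_(ij : 'I_p * 'I_p | (ij.1 < ij.2)%N)
     `|rho_tilde mu A ij.1 ij.2|.

End coherence.

Section probability_notions.
Variables (R : realType) (d : measure_display) (T : measurableType d)
  (P : probability T R).

(* The random variables X i are represented by plain functions; measurability
   is required separately. *)
Definition mutually_independent (I : finType) (X : I -> T -> R) : Prop :=
  forall (J : {set I}) (B : I -> set R), (forall i, measurable (B i)) ->
    P (\bigcap_(i in [set` J]) (X i @^-1` B i)) =
    (\prod_(i in J) P (X i @^-1` B i))%E.

(* Laws are compared on measurable sets only: the values of P on other sets
   carry no information. *)
Definition identically_distributed (I : finType) (X : I -> T -> R) : Prop :=
  forall (i j : I) (B : set R), measurable B ->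
    P (X i @^-1` B) = P (X j @^-1` B).

Definition iid (I : finType) (X : I -> T -> R) : Prop :=
  mutually_independent X /\ identically_distributed X.

(* 'M_P Y theta may be +oo, in which case theta contributes -oo to the
   supremum. *)
Definition rate_function (Y : T -> R) (x : R) : \bar R :=
  ereal_sup [set ((theta * x)%:E - lne ('M_P Y theta))%E | theta in [set: R]].

End probability_notions.

(* Main.v *)
(* Let U_ki = (x_ki - mu) / sigma. If both column sums of squares exceed n/2, then
   |rho_ij| >= t forces |sum_k U_ki U_kj| >= n t / 2, so a union bound reduces
   everything to Chernoff bounds for sums of independent copies of xi * eta and of
   xi^2.  The supremum defining the rate is attained on the correct half line of
   theta because, by Jensen, the moment generating function M satisfies
   M(theta) >= exp (theta * mean).

   The lower tail of sum_k U_ki U_kj is governed by M(-theta), not by M(theta), and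
   xi * eta need not be symmetric.  One still has M(-theta) <= M(theta) for
   theta >= 0: writing exp (theta u v) as the integral over z of k(u,z) k(v,z) with
   a Gaussian kernel k, and H(z), H'(z) for the expectations of k(xi,z), k(-xi,z),
   one gets M(theta) = int H^2 = int H'^2 and M(-theta) = int H H'.

   Positivity of the rates follows from exp y <= 1 + y + y^2 exp |y|, which gives
   M(theta) <= 1 + theta * mean + K theta^2 for small theta >= 0. *)
Require Import Defs.
From HB Require Import structures.
From mathcomp Require Import all_boot all_order all_algebra.
From mathcomp Require Import all_classical all_reals all_analysis.
From mathcomp Require Import measurable_realfun normal_distribution ring lra.
Set Implicit Arguments.
Unset Strict Implicit.
Unset Printing Implicit Defensive.
Import Order.TTheory GRing.Theory Num.Theory.
Import numFieldNormedType.Exports.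
Local Open Scope classical_set_scope.
Local Open Scope ring_scope.

(** * Independence *)

Section independence.
Context {R : realType} {d : measure_display} {T : measurableType d}.
Variable P : probability T R.
Local Open Scope ereal_scope.

(** The joint law of the pair agrees with [m1 \x m2] on rectangles, hence everywhere. Keeping [m1]
    and [m2] abstract allows one law, that of [xi], to serve in both factors. *)
Lemma integral_independent_pair d1 d2 (S1 : measurableType d1)
    (S2 : measurableType d2) (Z1 : {mfun T >-> S1}) (Z2 : {mfun T >-> S2})
    (m1 : {sigma_finite_measure set S1 -> \bar R})
    (m2 : {sigma_finite_measure set S2 -> \bar R}) (F : S1 * S2 -> \bar R) :
  (forall A B, measurable A -> measurable B ->
    P (Z1 @^-1` A `&` Z2 @^-1` B) = m1 A * m2 B) ->
  measurable_fun [set: S1 * S2] F -> (forall z, 0 <= F z) ->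
  \int[P]_w F (Z1 w, Z2 w) = \int[m1 \x m2]_z F z.
Proof.
move=> Z12 mF F0.
have mZ : measurable_fun setT (fun w => (Z1 w, Z2 w)) by exact: measurable_fun_pair.
pose Z : {mfun T >-> (S1 * S2)%type} := mfun_Sub (mem_set mZ).
rewrite [RHS](eq_measure_integral (distribution P Z)); last first.
  by move=> A mA _; apply: product_measure_unique => // B C; exact: Z12.
by apply/esym; exact: (@ge0_integral_distribution _ _ _ _ _ P Z F).
Qed.

(** For fixed [B], the finite measures [P (A]&[B)] and [P B * P A] in [A] agree on a pi-system,
    hence on the sigma-algebra that it generates. *)
Lemma g_sigma_algebra_independent (G1 G2 : set (set T)) :
  G1 `<=` measurable -> G2 `<=` measurable ->
  setI_closed G1 -> setI_closed G2 -> G1 setT -> G2 setT ->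
  (forall A B, G1 A -> G2 B -> P (A `&` B) = P A * P B) ->
  forall A B, <<s G1 >> A -> <<s G2 >> B -> P (A `&` B) = P A * P B.
Proof.
move=> mG1 mG2 IG1 IG2 TG1 TG2 G12.
have sG1 := smallest_sub (@sigma_algebra_measurable _ T) mG1.
have half (G H : set (set T)) : G `<=` measurable -> H `<=` measurable ->
    setI_closed G -> G setT ->
    (forall A B, G A -> H B -> P (A `&` B) = P A * P B) ->
    forall A B, <<s G >> A -> H B -> P (A `&` B) = P A * P B.
  move=> mG mH IG TG GH A B sA HB.
  have PB : P B \is a fin_num by exact: fin_num_measure (mH _ HB).
  pose c : {nonneg R} := NngNum (fine_ge0 (measure_ge0 P B)).
  have -> : P (A `&` B) = mrestr P (mH _ HB) A by [].
  rewrite muleC.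
  have -> : P B * P A = mscale c P A by rewrite /mscale/= fineK.
  apply: (g_sigma_algebra_measure_unique G mG (fun=> setT)) => //.
  - by rewrite bigcup_const.
  - by move=> C GC; rewrite /= /mrestr /mscale /= fineK// GH// muleC.
  - by move=> k; rewrite /= /mrestr setTI ltey_eq PB.
(* [G1] is extended against [G2] first; then [G2] is extended against [<<s G1 >>]. *)
move=> A B sA sB; rewrite setIC muleC.
apply: (half G2 <<s G1 >>) => // C D GC sD.
by rewrite setIC muleC; apply: (half G1 G2).
Qed.

(** * Sigma-algebras generated by subfamilies of an independent family *)

Section families.
Variables (I : finType) (X : I -> T -> R).

(** A pi-system generating the sigma-algebra of the [X i] with [i] in [J]. *)
Definition cylinders (J : {set I}) : set (set T) :=
  [set A | exists2 B : I -> set R, (forall i, measurable (B i)) &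
    A = \bigcap_(i in [set` J]) X i @^-1` B i].

Lemma cylinders_setI_closed J : setI_closed (cylinders J).
Proof.
move=> _ _ [B mB ->] [C mC ->]; exists (fun i => B i `&` C i) => [i|].
  exact: measurableI.
by rewrite -bigcapI.
Qed.

Lemma cylindersT J : cylinders J setT.
Proof. by exists (fun=> setT) => //; rewrite bigcapT. Qed.

Lemma cylinders_sub (J K : {set I}) :
  J \subset K -> cylinders J `<=` cylinders K.
Proof.
move=> /fintype.subsetP JK _ [B mB ->].
exists (fun i => if i \in J then B i else setT) => [i|]; first by case: ifP.
apply/seteqP; split => w wB i /= iJ.
  by case: ifPn => // /wB.
by have /= := wB _ (JK _ iJ); rewrite iJ.
Qed.

Hypothesis mX : forall i, measurable_fun setT (X i).

Lemma cylinders_measurable J : cylinders J `<=` measurable.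
Proof.
move=> _ [B mB ->]; apply: fin_bigcap_measurable => // i _.
by rewrite -[_ @^-1` _]setTI; exact: mX.
Qed.

Hypothesis indX : mutually_independent P X.

(** By disjointness the two choices of Borel sets merge into one, so the intersection is a cylinder
    over [J :|: K] and its product formula splits. *)
Lemma cylinders_independent (J K : {set I}) : [disjoint J & K]%B ->
  forall A B, cylinders J A -> cylinders K B -> P (A `&` B) = P A * P B.
Proof.
move=> dJK _ _ [B mB ->] [C mC ->].
pose D i := if i \in J then B i else C i.
have mD i : measurable (D i) by rewrite /D; case: ifP.
rewrite (_ : _ `&` _ = \bigcap_(i in [set` J :|: K]) X i @^-1` D i).
  rewrite !indX//.
  rewrite [LHS](eq_bigl [in [predU J & K]]) => [|i]; last by rewrite !inE.
  rewrite bigU//=; congr (_ * _); apply: eq_bigr => i.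
    by rewrite /D => ->.
  by rewrite /D => iK; rewrite (disjointFl dJK iK).
apply/seteqP; split => w.
  move=> [wB wC] i /=; rewrite inE /D; case: ifPn => [iJ _|_ /= iK]; [exact: wB|exact: wC].
move=> wD; split=> i /= iJ; have := wD i; rewrite /= inE iJ ?orbT /D => /(_ isT).
  by rewrite iJ.
by rewrite (disjointFl dJK iJ).
Qed.

(** Expresses that [f] depends only on the coordinates in [J]. *)
Definition cyl_measurable (J : {set I}) (f : T -> R) :=
  measurable_fun [set: g_sigma_algebraType (cylinders J)]
    (f : g_sigma_algebraType (cylinders J) -> R).

Lemma cyl_measurable_coord (J : {set I}) i : i \in J -> cyl_measurable J (X i).
Proof.
move=> iJ _ B mB; rewrite setTI; apply: sub_sigma_algebra.
exists (fun j => if j == i then B else setT) => [j|]; first by case: ifP.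
apply/seteqP; split => w.
  by move=> wB j _ /=; case: eqP => // ->.
by move=> /(_ i iJ); rewrite /= eqxx.
Qed.

Lemma cyl_measurable_sub (J K : {set I}) f : J \subset K ->
  cyl_measurable J f -> cyl_measurable K f.
Proof.
move=> JK mf _ B mB; have := mf measurableT B mB.
apply: sub_smallest2r; first exact: smallest_sigma_algebra.
exact: cylinders_sub.
Qed.

(** The identity maps into the two sub-sigma-algebras are independent random elements, so the
    integral passes to a product measure and factorizes by Tonelli. *)
Lemma integral_independentM (J K : {set I}) (f g : T -> R) : [disjoint J & K]%B ->
  cyl_measurable J f -> cyl_measurable K g ->
  (forall w, 0 <= f w)%R -> (forall w, 0 <= g w)%R ->
  \int[P]_w (f w * g w)%:E = (\int[P]_w (f w)%:E) * (\int[P]_w (g w)%:E).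
Proof.
move=> dJK mf mg f0 g0.
(* [TJ] and [TK] are [T] itself with the sub-sigma-algebras generated by the families. *)
pose TJ := g_sigma_algebraType (cylinders J).
pose TK := g_sigma_algebraType (cylinders K).
have sm L A : <<s cylinders L >> A -> measurable A.
  apply: smallest_sub; first exact: sigma_algebra_measurable.
  exact: cylinders_measurable.
have mJ : measurable_fun setT (id : T -> TJ).
  by move=> _ A mA; rewrite setTI; exact: sm mA.
have mK : measurable_fun setT (id : T -> TK).
  by move=> _ A mA; rewrite setTI; exact: sm mA.
pose ZJ : {mfun T >-> TJ} := mfun_Sub (mem_set mJ).
pose ZK : {mfun T >-> TK} := mfun_Sub (mem_set mK).
pose F (z : TJ * TK) : \bar R := (f z.1 * g z.2)%:E.
have mF : measurable_fun setT F.
  apply/measurable_EFinP; apply: measurable_funM.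
    exact: (measurableT_comp mf measurable_fst).
  exact: (measurableT_comp mg measurable_snd).
rewrite (@integral_independent_pair _ _ _ _ ZJ ZK
  (distribution P ZJ) (distribution P ZK) F) => //; last 2 first.
- move=> A B mA mB.
  apply: (@g_sigma_algebra_independent (cylinders J) (cylinders K)) => //.
  + exact: cylinders_measurable.
  + exact: cylinders_measurable.
  + exact: cylinders_setI_closed.
  + exact: cylinders_setI_closed.
  + exact: cylindersT.
  + exact: cylindersT.
  + exact: cylinders_independent.
- by move=> z; rewrite lee_fin mulr_ge0.
rewrite fubini_tonelli1//=; last by move=> z; rewrite lee_fin mulr_ge0.
have mg' : measurable_fun [set: TK] (EFin \o g) by exact/measurable_EFinP.
have mf' : measurable_fun [set: TJ] (EFin \o f) by exact/measurable_EFinP.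
under eq_integral => x _.
  rewrite /fubini_F /F/=.
  under eq_integral do rewrite EFinM.
  rewrite ge0_integralZl//; [|by move=> y _; rewrite lee_fin|by rewrite lee_fin].
  over.
rewrite ge0_integralZr//; last 2 first.
- by move=> x _; rewrite lee_fin.
- by apply: integral_ge0 => y _; rewrite lee_fin.
congr (_ * _); last first.
  by rewrite (@ge0_integral_distribution _ _ _ _ _ P ZK (EFin \o g))//
    => y; rewrite lee_fin.
by rewrite (@ge0_integral_distribution _ _ _ _ _ P ZJ (EFin \o f))//
  => y; rewrite lee_fin.
Qed.

Lemma integral_independent_prod (K : finType) (s : seq K) (J : K -> {set I})
    (f : K -> T -> R) : uniq s ->
  {in s &, forall k l, k != l -> [disjoint J k & J l]%B} ->
  (forall k, cyl_measurable (J k) (f k)) -> (forall k w, 0 <= f k w)%R ->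
  \int[P]_w (\prod_(k <- s) f k w)%:E = \prod_(k <- s) \int[P]_w (f k w)%:E.
Proof.
move=> us dJ mf f0; elim: s us dJ => [_ _|k s ih /= /andP[ks us] dJ].
  rewrite big_nil; under eq_integral do rewrite big_nil.
  by have := expectation_cst P 1%R; rewrite unlock.
rewrite big_cons -ih//; last first.
  by move=> a b sa sb; apply: dJ; rewrite inE ?sa ?sb orbT.
under eq_integral do rewrite big_cons.
(* The product over the tail depends on the union of the remaining blocks, which is disjoint from
   [J k]. *)
apply: (@integral_independentM (J k) (\bigcup_(l in s) J l)%SET).
- apply/bigcup_disjointP => l ls; apply: dJ; rewrite ?inE ?eqxx ?ls ?orbT//.
  by apply: contraNneq ks => ->.
- exact: mf.
- apply: measurable_prod => l ls; apply: cyl_measurable_sub (mf l).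
  exact: finset.bigcup_sup.
- exact: f0.
- by move=> w; apply: prodr_ge0.
Qed.

End families.
End independence.

(** * Comparison of the two tails of a product *)

Section gaussian.
Context {R : realType}.
Local Notation leb := (@lebesgue_measure R).

(** Tuned so that completing the square in a product of two kernels leaves [expR (s ^+ 2 * (u * v))]
    times the Gaussian density in [z] of mean [s * (u + v)] and variance 1; each kernel carries the
    square root of the normalizing constant. *)
Definition gauss_kernel (s u z : R) : R :=
  Num.sqrt (normal_peak 1) * expR (- (z ^+ 2) / 4 + s * z * u - s ^+ 2 * u ^+ 2 / 2).

Lemma gauss_kernel_ge0 s u z : 0 <= gauss_kernel s u z.
Proof. by rewrite mulr_ge0// ?sqrtr_ge0// expR_ge0. Qed.

Lemma gauss_kernelM s u v z :
  gauss_kernel s u z * gauss_kernel s v z =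
  expR (s ^+ 2 * (u * v)) * normal_pdf (s * (u + v)) 1 z.
Proof.
rewrite normal_pdfE// /gauss_kernel /normal_fun mulrACA -expr2 sqr_sqrtr ?normal_peak_ge0//.
rewrite [RHS]mulrCA -!expRD; congr (_ * expR _).
by field.
Qed.

Lemma integral_gauss_kernelM s u v :
  (\int[leb]_z (gauss_kernel s u z * gauss_kernel s v z)%:E =
   (expR (s ^+ 2 * (u * v)))%:E)%E.
Proof.
under eq_integral do rewrite gauss_kernelM EFinM.
rewrite ge0_integralZl//=; last 2 first.
- by apply/measurable_EFinP; exact: measurable_normal_pdf.
- by move=> z _; rewrite lee_fin normal_pdf_ge0.
by rewrite integral_normal_pdf// mule1.
Qed.

Lemma measurable_gauss_kernel s d (S : measurableType d) (a b : S -> R) :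
  measurable_fun setT a -> measurable_fun setT b ->
  measurable_fun setT (fun x => gauss_kernel s (a x) (b x)).
Proof.
move=> ma mb; apply: measurable_funM => //; apply: measurableT_comp => //.
apply: measurable_funB; last first.
  apply: measurable_funM => //; apply: measurable_funM => //.
  exact: measurable_funX.
apply: measurable_funD; last by do 2 apply: measurable_funM => //.
apply: measurable_funM => //; apply: measurableT_comp => //.
exact: measurable_funX.
Qed.

Variable mu : {sigma_finite_measure set R -> \bar R}.
Local Open Scope ereal_scope.

Lemma measurable_integral_gauss_kernel (s : R) (a : R -> R) :
  measurable_fun setT a ->
  measurable_fun [set: R] (fun z => \int[mu]_u (gauss_kernel s (a u) z)%:E).
Proof.
move=> ma; apply: (measurable_fun_fubini_tonelli_G
  (fun x : R * R => (gauss_kernel s (a x.1) x.2)%:E)).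
  apply/measurable_EFinP; apply: measurable_gauss_kernel => //.
  exact: measurableT_comp.
by move=> x; rewrite lee_fin gauss_kernel_ge0.
Qed.

(** The exponential is replaced by its Gaussian integral over [z], which is then moved outside the
    integrals in [v] and in [u] by Tonelli. The functions [a] and [b] stand for the identity or the
    negation. *)
Lemma integral_expR_gauss (s : R) (a b : R -> R) :
  measurable_fun setT a -> measurable_fun setT b ->
  \int[mu \x mu]_z (expR (s ^+ 2 * (a z.1 * b z.2)))%:E =
  \int[leb]_z ((\int[mu]_u (gauss_kernel s (a u) z)%:E) *
               (\int[mu]_u (gauss_kernel s (b u) z)%:E)).
Proof.
move=> ma mb.
pose B (z : R) := \int[mu]_v (gauss_kernel s (b v) z)%:E.
have mB : measurable_fun setT B by exact: measurable_integral_gauss_kernel.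
have B0 z : 0 <= B z.
  by apply: integral_ge0 => v _; rewrite lee_fin gauss_kernel_ge0.
have mk (c : R -> R) z : measurable_fun setT c ->
    measurable_fun setT (fun u => (gauss_kernel s (c u) z)%:E).
  by move=> mc; apply/measurable_EFinP; exact: measurable_gauss_kernel.
have k0 u z : 0 <= (gauss_kernel s u z)%:E by rewrite lee_fin gauss_kernel_ge0.
rewrite fubini_tonelli1; last 2 first.
- apply/measurable_EFinP; apply: measurableT_comp => //.
  apply: measurable_funM => //; apply: measurable_funM.
    exact: measurableT_comp.
  exact: measurableT_comp.
- by move=> z; rewrite lee_fin expR_ge0.
transitivity (\int[mu]_u \int[leb]_z ((gauss_kernel s (a u) z)%:E * B z)).
  apply: eq_integral => u _; rewrite /fubini_F/=.
  under eq_integral do rewrite -integral_gauss_kernelM.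
  pose F (x : R * R) : \bar R :=
    (gauss_kernel s (a u) x.2 * gauss_kernel s (b x.1) x.2)%:E.
  rewrite -[LHS]/(\int[mu]_v \int[leb]_z F (v, z)) fubini_tonelli; last 2 first.
  - apply/measurable_EFinP; apply: measurable_funM; apply: measurable_gauss_kernel => //.
    exact: measurableT_comp.
  - by move=> x; rewrite lee_fin mulr_ge0// gauss_kernel_ge0.
  apply: eq_integral => z _; rewrite /F/=.
  under eq_integral do rewrite EFinM.
  by rewrite ge0_integralZl//; exact: mk.
pose F (x : R * R) := (gauss_kernel s (a x.1) x.2)%:E * B x.2.
rewrite -[LHS]/(\int[mu]_u \int[leb]_z F (u, z)) fubini_tonelli; last 2 first.
- apply: emeasurable_funM; last exact: measurableT_comp.
  apply/measurable_EFinP; apply: measurable_gauss_kernel => //.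
  exact: measurableT_comp.
- by move=> x; rewrite mule_ge0.
by apply: eq_integral => z _; rewrite /F/= ge0_integralZr//; exact: mk.
Qed.

(** Needed on extended reals, since the kernel averages it is applied to may be infinite. *)
Lemma mule2n_le_sqrD (x y : \bar R) : 0 <= x -> 0 <= y ->
  2%:E * (x * y) <= x * x + y * y.
Proof.
case: x => [x| |]//; case: y => [y| |]// x0 y0.
- rewrite -!EFinM -EFinD lee_fin; have := sqr_ge0 (x - y)%R; nra.
- by rewrite mulyy addey ?leey// -EFinM.
- by rewrite mulyy addye ?leey// -EFinM.
- by rewrite mulyy addye ?leey.
Qed.

(** Integrating [2 H H' <= H ^ 2 + H' ^ 2] over [z], where [H] and [H'] are the kernel averages of
    [u] and [- u], bounds twice the left side by twice the right side. *)
Lemma integral_expRN_le (t : R) : (0 <= t)%R ->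
  \int[mu \x mu]_z (expR (- t * (z.1 * z.2)))%:E <=
  \int[mu \x mu]_z (expR (t * (z.1 * z.2)))%:E.
Proof.
move=> t0; have ts : t = ((Num.sqrt t) ^+ 2)%R by rewrite sqr_sqrtr.
move: (Num.sqrt t) ts => s ->.
have mN : measurable_fun [set: R] (-%R : R -> R) by exact: measurable_funN.
have mid : measurable_fun [set: R] (@id R) by exact: measurable_id.
pose H (c : R -> R) z := \int[mu]_u (gauss_kernel s (c u) z)%:E.
have H0 c z : 0 <= H c z.
  by apply: integral_ge0 => u _; rewrite lee_fin gauss_kernel_ge0.
have mH c : measurable_fun setT c -> measurable_fun setT (H c).
  exact: measurable_integral_gauss_kernel.
have E1 := integral_expR_gauss s mid mid.
have E2 := integral_expR_gauss s mid mN.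
have E3 := integral_expR_gauss s mN mN.
(* Negating both variables keeps their product, so the square of [H -%R] has the same integral as
   that of [H id]. *)
have {}E3 : \int[mu \x mu]_z (expR (s ^+ 2 * (z.1 * z.2)))%:E =
    \int[leb]_z (H -%R z * H -%R z).
  by rewrite -E3; apply: eq_integral => z _; rewrite mulrNN.
have {}E2 : \int[mu \x mu]_z (expR (- s ^+ 2 * (z.1 * z.2)))%:E =
    \int[leb]_z (H id z * H -%R z).
  by rewrite -E2; apply: eq_integral => z _; rewrite mulrN mulNr mulrN.
rewrite -(@lee_pmul2l _ 2%:E)// E2 -ge0_integralZl//; last 2 first.
- by apply: emeasurable_funM; exact: mH.
- by move=> z _; rewrite mule_ge0.
rewrite [leRHS](_ : _ = \int[leb]_z (H id z * H id z + H -%R z * H -%R z)).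
  apply: ge0_le_integral => //.
  - by move=> z _; rewrite !mule_ge0.
  - by apply: emeasurable_funM => //; apply: emeasurable_funM; exact: mH.
  - by apply: emeasurable_funD; apply: emeasurable_funM; exact: mH.
  - by move=> z _; exact: mule2n_le_sqrD.
rewrite ge0_integralD//; last 4 first.
- by move=> z _; rewrite mule_ge0.
- by apply: emeasurable_funM; exact: mH.
- by move=> z _; rewrite mule_ge0.
- by apply: emeasurable_funM; exact: mH.
by rewrite -E3 -[X in _ = X + _]E1 mule_natl mule2n.
Qed.
End gaussian.

(** * Moment generating functions and rate functions *)

Section exp_inequalities.
Context {R : realType}.
Implicit Types x y c : R.

(** Write [x * expR x = x + x * (expR x - 1)] and use [x <= expR x - 1 <= x * expR x]: the upper
    bound for [x >= 0], the lower one for [x < 0]. *)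
Lemma expR_le_quadratic x : expR x <= 1 + x + x ^+ 2 * expR `|x|.
Proof.
have h1 := expR_ge1Dx x.
have h2 : expR x - 1 <= x * expR x.
  have := expR_ge1Dx (- x).
  rewrite expRN -(ler_pM2r (expR_gt0 x)) mulVf ?gt_eqF ?expR_gt0//.
  lra.
have [x0|x0] := leP 0 x.
  by rewrite ger0_norm//; nra.
have h3 : 1 <= expR `|x| by rewrite -expR0 ler_expR.
nra.
Qed.

Lemma sqr_le_expR x : x ^+ 2 <= 4 * expR `|x|.
Proof.
have := expR_ge1Dx (`|x| / 2); rewrite -real_normK ?num_real// => h.
rewrite {2}[`|x|](splitr) expRD.
have := normr_ge0 x; nra.
Qed.

Lemma normrM_le_maxsqr x y : `|x * y| <= Num.max (x ^+ 2) (y ^+ 2).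
Proof.
have := sqr_ge0 (`|x| - `|y|); rewrite sqrrB !real_normK ?num_real// normrM.
by move=> h; case: (leP (x ^+ 2) (y ^+ 2)) => xy; lra.
Qed.

Lemma normr_le1Dsqr x : `|x| <= 1 + x ^+ 2.
Proof.
have := sqr_ge0 (`|x| - 1); rewrite sqrrB real_normK ?num_real//.
have := normr_ge0 x; lra.
Qed.

(** The exponential of a maximum is at most the sum of the exponentials. The bound separates the
    variables, so only the two marginal laws enter its integral. *)
Lemma expR_mul_norm_le c x y : 0 <= c ->
  expR (c * `|x * y|) <= expR (c * x ^+ 2) + expR (c * y ^+ 2).
Proof.
move=> c0; have : expR (c * `|x * y|) <= expR (c * Num.max (x ^+ 2) (y ^+ 2)).
  by rewrite ler_expR ler_wpM2l// normrM_le_maxsqr.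
have := expR_ge0 (c * x ^+ 2); have := expR_ge0 (c * y ^+ 2).
by case: (leP (x ^+ 2) (y ^+ 2)) => _; lra.
Qed.

Lemma expR_norm_le c x : 0 <= c ->
  expR (c * `|x|) <= expR c * expR (c * x ^+ 2).
Proof.
move=> c0; rewrite -expRD ler_expR -[X in X + _]mulr1 -mulrDr.
by rewrite ler_wpM2l// normr_le1Dsqr.
Qed.
End exp_inequalities.

Lemma lee_expe (R : realDomainType) (x y : \bar R) (n : nat) :
  (0 <= x -> x <= y -> x ^+ n <= y ^+ n)%E.
Proof.
move=> x0 xy; elim: n => // n IH; rewrite !expeS.
by apply: lee_pmul => //; exact: expe_ge0.
Qed.

(** * Chernoff bounds through the rate function, and positivity of rates *)

Section mgf.
Context {R : realType} {d : measure_display} {T : measurableType d}.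
Variable P : probability T R.
Local Open Scope ereal_scope.

Lemma mmt_gen_funE (Y : T -> R) t : 'M_P Y t = \int[P]_w (expR (t * Y w))%:E.
Proof.
rewrite /mmt_gen_fun unlock; apply: eq_integral => w _ /=.
by rewrite mulrC.
Qed.

Lemma mmt_gen_fun_ge0 (Y : T -> R) t : 0 <= 'M_P Y t.
Proof. by rewrite mmt_gen_funE integral_ge0// => w _; rewrite lee_fin expR_ge0. Qed.

Lemma mmt_gen_funN (Y : T -> R) t : 'M_P (\- Y)%R t = 'M_P Y (- t).
Proof.
by rewrite !mmt_gen_funE; apply: eq_integral => w _ /=; rewrite mulrN mulNr.
Qed.

(** Turns the lower tail of a sum of squares into an upper tail for [\- Y]. *)
Lemma rate_functionN (Y : T -> R) x :
  rate_function P (\- Y)%R (- x) = rate_function P Y x.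
Proof.
rewrite /rate_function; congr ereal_sup; apply/seteqP; split => _ [t _ <-].
  by exists (- t)%R => //; rewrite mmt_gen_funN mulrN mulNr.
by exists (- t)%R => //; rewrite mmt_gen_funN opprK mulrNN.
Qed.

(** For [q > 0], taking logarithms makes [- ln q / n] an upper bound of all terms of the supremum. A
    term equal to [+oo] would force [q <= 0]. *)
Lemma le_expeR_rate_function (Y : T -> R) (n : nat) (x : R) (q : \bar R) : (0 < n)%N ->
  0 <= q -> q \is a fin_num ->
  (forall t : R, q <= expeR (- (n%:R%:E * ((t * x)%:E - lne ('M_P Y t))))) ->
  q <= expeR (- (n%:R%:E * rate_function P Y x)).
Proof.
move=> n0; case: q => // r; rewrite lee_fin le_eqVlt => /predU1P[<- _ _|r0 _ H].
  exact: expeR_ge0.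
have n0R : (0 < n%:R :> R)%R by rewrite ltr0n.
have rE : r%:E = expeR (ln r)%:E by rewrite /= lnK.
have : rate_function P Y x <= (- (ln r / n%:R))%:E.
  apply: ge_ereal_sup => _ [t _ <-]; have := H t.
  set s := (_ - lne _); case: s => [s| |_]; last by rewrite leNye.
  - rewrite rE lee_expeR -EFinM -EFinN !lee_fin => h.
    by rewrite lerNr ler_pdivrMr// mulNr mulrC.
  - by rewrite gt0_muley ?lte_fin//= lee_fin leNgt r0.
move=> h; rewrite rE lee_expeR leeNr.
rewrite (_ : - (ln r)%:E = n%:R%:E * (- (ln r / n%:R))%:E).
  by rewrite lee_pmul2l// lte_fin.
by rewrite -EFinM mulrN mulrCA divff ?mulr1// gt_eqF.
Qed.

(** Positive [t] give the exponential Markov bound. For [t < 0] the second hypothesis makes the term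
    of the supremum nonpositive, and [t = 0] gives the term 0; such terms only claim a bound at
    least 1. *)
Lemma chernoff_rate_function (S : {RV P >-> R}) (Y : T -> R) (n : nat) (x : R) :
  (0 < n)%N ->
  (forall t : R, (0 <= t)%R -> 'M_P S t <= 'M_P Y t ^+ n) ->
  (forall t : R, (t < 0)%R -> (expR (t * x))%:E <= 'M_P Y t) ->
  P [set w | (n%:R * x <= S w)%R] <=
    expeR (- (n%:R%:E * rate_function P Y x)).
Proof.
move=> n0 MS MY.
have mA : measurable [set w | (n%:R * x <= S w)%R].
  rewrite (_ : [set _ | _] = S @^-1` `[n%:R * x, +oo[%classic)%R.
    by rewrite -[_ @^-1` _]setTI; exact: measurable_funP.
  by apply/seteqP; split => w /=; rewrite in_itv/= andbT.
have PA1 := probability_le1 P mA.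
apply: le_expeR_rate_function => //; first exact: fin_num_measure.
move=> t; have n0R : (0 < n%:R :> R)%R by rewrite ltr0n.
have ge1 (s : \bar R) : s <= 0 ->
    P [set w | (n%:R * x <= S w)%R] <= expeR (- (n%:R%:E * s)).
  move=> s0; apply: le_trans PA1 _; rewrite -expeR0 lee_expeR leeNr oppe0.
  by rewrite mule_ge0_le0// lee_fin.
have [t0|t0|->] := ltgtP t 0%R; last 2 first.
- have := chernoff S (n%:R * x) t0; move=> /le_trans; apply.
  apply: (@le_trans _ _ ('M_P Y t ^+ n * (expR (- (t * (n%:R * x))))%:E)).
    by rewrite lee_pmul2r// ?lte_fin ?expR_gt0//; apply: MS; exact: ltW.
  have := mmt_gen_fun_ge0 Y t.
  case: ('M_P Y t) => [m| |]//; last first.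
    by move=> _; rewrite /lne/= addeNy ?gt0_muleNy ?lte_fin//= leey.
  rewrite lee_fin le_eqVlt => /predU1P[<-|m0].
    by rewrite -EFin_expe expr0n gtn_eqF// mul0e expeR_ge0.
  rewrite lne_EFin// -EFinB -EFinM -EFinN /= -EFin_expe -EFinM lee_fin.
  rewrite -{1}[m]lnK// -expRM_natl -expRD ler_expR; lra.
- by apply: ge1; rewrite mmt_gen_funE mul0r; under eq_integral do rewrite mul0r expR0;
    rewrite (_ : \int[P]_ _ _ = 1) ?lne1 ?sube0//;
    have := expectation_cst P 1%R; rewrite unlock.
- apply: ge1; have := MY _ t0.
  case: ('M_P Y t) => [m| |]//; last by rewrite /= addeNy leNye.
  rewrite lee_fin => h; have m0 : (0 < m)%R by exact: lt_le_trans (expR_gt0 _) h.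
  by rewrite lne_EFin// -EFinB lee_fin subr_le0 -ler_expR lnK.
Qed.

Section exponential_moment.
Variables (Y : T -> R) (c : R).
Hypotheses (mY : measurable_fun setT Y) (c0 : (0 < c)%R).
Hypothesis Yexp : \int[P]_w (expR (c * `|Y w|))%:E < +oo.

Lemma integrable_expR_norm : P.-integrable setT (fun w => (expR (c * `|Y w|))%:E).
Proof.
apply/integrableP; split.
  apply/measurable_EFinP; apply: measurableT_comp => //.
  by apply: measurable_funM => //; exact: measurableT_comp.
by under eq_integral do rewrite gee0_abs ?lee_fin ?expR_ge0//.
Qed.

Lemma integrable_of_expR_norm : P.-integrable setT (EFin \o Y).
Proof.
apply: (@le_integrable _ _ _ _ _ measurableT _
  (fun w => (c^-1)%:E * (expR (c * `|Y w|))%:E)).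
- exact/measurable_EFinP.
- move=> w _; rewrite -EFinM !abse_EFin lee_fin [leRHS]ger0_norm; last first.
    by rewrite mulr_ge0 ?expR_ge0// invr_ge0 ltW.
  rewrite ler_pdivlMl//; apply: le_trans (expR_ge1Dx _); lra.
- exact: (integrableZl measurableT _ integrable_expR_norm).
Qed.

Variable m : R.
Hypothesis EY : \int[P]_w (Y w)%:E = m%:E.

Lemma integrable_affine a b : P.-integrable setT (fun w => (a + b * Y w)%:E).
Proof.
under eq_fun do rewrite EFinD EFinM.
apply: integrableD => //; last exact: (integrableZl measurableT _ integrable_of_expR_norm).
exact: (finite_measure_integrable_cst P a).
Qed.

Lemma integral_affine a b : \int[P]_w (a + b * Y w)%:E = (a + b * m)%:E.
Proof.
under eq_integral do rewrite EFinD EFinM.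
rewrite integralD//; last 2 first.
- exact: (finite_measure_integrable_cst P a).
- exact: (integrableZl measurableT _ integrable_of_expR_norm).
rewrite integralZl//; last exact: integrable_of_expR_norm.
have := expectation_cst P a; rewrite unlock /= => ->.
by rewrite EY.
Qed.

(** Jensen's inequality, by integrating the tangent line of the exponential at [t * m]. *)
Lemma expR_mean_le_mmt_gen_fun t : (expR (t * m))%:E <= 'M_P Y t.
Proof.
rewrite mmt_gen_funE.
have mE : measurable_fun setT (fun w => (expR (t * Y w))%:E).
  by apply/measurable_EFinP; apply: measurableT_comp => //; exact: measurable_funM.
have [->|fin] := eqVneq (\int[P]_w (expR (t * Y w))%:E) +oo; first by rewrite leey.
rewrite [leLHS](_ : _ = \int[P]_w (expR (t * m) * (1 - t * m) + expR (t * m) * t * Y w)%:E).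
  apply: le_integral => //; first exact: integrable_affine.
    apply/integrableP; split => //.
    under eq_integral do rewrite gee0_abs ?lee_fin ?expR_ge0//.
    by rewrite ltey.
  move=> w _; rewrite lee_fin.
  have := expR_ge1Dx (t * Y w - t * m).
  rewrite expRD expRN ler_pdivlMr ?expR_gt0//; lra.
rewrite integral_affine; congr EFin; ring.
Qed.

(** For small [t > 0] the logarithm of the moment generating function is at most
    [t * m + K * t ^+ 2], and the gain [t * (x - m)] beats [K * t ^+ 2]. *)
Lemma rate_function_gt0 x : (m < x)%R -> 0 < rate_function P Y x.
Proof.
move=> mx; pose E := \int[P]_w (expR (c * `|Y w|))%:E.
have E0 : 0 <= E by apply: integral_ge0 => w _; rewrite lee_fin expR_ge0.
have Efin : E \is a fin_num by rewrite ge0_fin_numE.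
(* The inequality [y ^+ 2 <= 4 * expR |y|] at [y = c / 2 * Y w] yields [16 / c ^+ 2] and uses half
   of the exponent [c]; the other half absorbs [expR (t * |Y w|)] for [t <= c / 2]. *)
pose K := (16 / c ^+ 2 * fine E)%R.
have K0 : (0 <= K)%R by rewrite mulr_ge0 ?fine_ge0// divr_ge0// sqr_ge0.
have MK t : (0 <= t)%R -> (t <= c / 2)%R -> 'M_P Y t <= (1 + t * m + K * t ^+ 2)%:E.
  move=> t0 tc; rewrite mmt_gen_funE.
  have iE := integrable_expR_norm.
  rewrite [leRHS](_ : _ = \int[P]_w ((1 + t * Y w)%:E +
      (16 / c ^+ 2 * t ^+ 2)%:E * (expR (c * `|Y w|))%:E)); last first.
    rewrite integralD//; [|exact: integrable_affine|exact: integrableZl].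
    rewrite integral_affine integralZl// -/E -[E in _ * E]fineK// -EFinM -EFinD.
    by congr EFin; rewrite /K; ring.
  apply: ge0_le_integral => //.
  - by apply/measurable_EFinP; apply: measurableT_comp => //; exact: measurable_funM.
  - apply: emeasurable_funD; first by case/integrableP: (integrable_affine 1 t).
    by apply: emeasurable_funM => //; case/integrableP: iE.
  - move=> w _; rewrite -EFinM -EFinD lee_fin.
    apply: le_trans (expR_le_quadratic _) _; rewrite lerD2l.
    have h := sqr_le_expR (c / 2 * Y w).
    have c2 : (0 <= c / 2)%R by lra.
    rewrite normrM (ger0_norm c2) in h.
    rewrite normrM (ger0_norm t0).
    rewrite [(c * _)%R](_ : _ = c / 2 * `|Y w| + c / 2 * `|Y w|)%R; last by field.
    rewrite expRD.
    have h2 : (expR (t * `|Y w|) <= expR (c / 2 * `|Y w|))%R.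
      by rewrite ler_expR ler_wpM2r.
    have h3 : (Y w ^+ 2 <= 16 / c ^+ 2 * expR (c / 2 * `|Y w|))%R.
      rewrite mulrAC ler_pdivlMr ?exprn_gt0//; lra.
    rewrite exprMn; move: h2 h3; set e := expR (c / 2 * `|Y w|) => h2 h3.
    rewrite (_ : 16 / c ^+ 2 * t ^+ 2 * (e * e) = t ^+ 2 * (16 / c ^+ 2 * e) * e)%R;
      last by ring.
    apply: ler_pM => //; first by rewrite mulr_ge0 ?sqr_ge0.
    by apply: ler_wpM2l => //; exact: sqr_ge0.
(* The second bound gives [K * t <= (x - m) / 2]; [K + 1] keeps the denominator positive when [K] is
   0. *)
pose t := Num.min (c / 2)%R ((x - m) / (2 * (K + 1)))%R.
have K1 : (0 < 2 * (K + 1))%R by lra.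
have t0 : (0 < t)%R by rewrite lt_min !divr_gt0// subr_gt0.
have tc : (t <= c / 2)%R by rewrite ge_min lexx.
have tK : (t * (2 * (K + 1)) <= x - m)%R by rewrite -ler_pdivlMr// ge_min lexx orbT.
apply: (@lt_le_trans _ _ ((t * x)%:E - lne ('M_P Y t))); last first.
  by apply: ereal_sup_ubound; exists t.
have : 'M_P Y t <= (expR (t * m + K * t ^+ 2))%:E.
  apply: le_trans (MK _ (ltW t0) tc) _; rewrite lee_fin -addrA; exact: expR_ge1Dx.
have := expR_mean_le_mmt_gen_fun t.
case: ('M_P Y t) => [r| |]//; rewrite !lee_fin => r1 r2.
have r0 : (0 < r)%R by exact: lt_le_trans (expR_gt0 _) r1.
rewrite lne_EFin// -EFinB lte_fin subr_gt0 -ltr_expR lnK//.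
apply: le_lt_trans r2 _; rewrite ltr_expR; nra.
Qed.

End exponential_moment.
End mgf.

(** * Sums over the entries of an i.i.d. array *)

Section coherence_event.
Context {R : realType} {n p : nat}.
Implicit Types (A : 'M[R]_(n, p)) (mu sigma t : R) (i j : 'I_p).

(** The scale [sigma] cancels from the quotient. If a centered column vanishes, both sides are 0 by
    the convention on division. *)
Lemma rho_tildeE A mu sigma (u : 'I_n -> 'I_p -> R) i j : 0 < sigma ->
  (forall k l, A k l - mu = sigma * u k l) ->
  rho_tilde mu A i j = (\sum_k u k i * u k j) /
    (Num.sqrt (\sum_k u k i ^+ 2) * Num.sqrt (\sum_k u k j ^+ 2)).
Proof.
move=> s0 uE.
have cE k l : centered_col mu A l k ord0 = sigma * u k l.
  by rewrite -uE /centered_col !mxE.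
have nE l : euclidean_norm (centered_col mu A l) =
    sigma * Num.sqrt (\sum_k u k l ^+ 2).
  rewrite /euclidean_norm; under eq_bigr do rewrite cE exprMn.
  by rewrite -mulr_sumr sqrtrM ?sqr_ge0// sqrtr_sqr gtr0_norm.
rewrite /rho_tilde !nE mxE.
under eq_bigr do rewrite mxE !cE mulrACA.
by rewrite -mulr_sumr mulrACA -mulf_div divff ?mul1r// mulf_neq0 ?gt_eqF.
Qed.

(** If the last two alternatives fail, both norms exceed [Num.sqrt (n%:R / 2)], so their product
    times [t] is at least [n%:R * (t / 2)]. All four have the upper-tail form of the Chernoff
    bound. *)
Lemma rho_tilde_ge A mu sigma t (u : 'I_n -> 'I_p -> R) i j :
  0 < sigma -> 0 < t -> (forall k l, A k l - mu = sigma * u k l) ->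
  t <= `|rho_tilde mu A i j| ->
  [\/ n%:R * (t / 2) <= \sum_k u k i * u k j,
      n%:R * (t / 2) <= - \sum_k u k i * u k j,
      n%:R * - (1 / 2) <= - \sum_k u k i ^+ 2 |
      n%:R * - (1 / 2) <= - \sum_k u k j ^+ 2].
Proof.
move=> s0 t0 uE; rewrite (rho_tildeE i j s0 uE).
set S := \sum_k u k i * u k j; set Qi := \sum_k u k i ^+ 2.
set Qj := \sum_k u k j ^+ 2 => tS.
have n0 : 0 <= n%:R :> R by [].
have [?|Qin] := leP (n%:R * - (1 / 2)) (- Qi); first exact: Or43.
have [?|Qjn] := leP (n%:R * - (1 / 2)) (- Qj); first exact: Or44.
have Qi0 : 0 < Qi by lra.
have Qj0 : 0 < Qj by lra.
suff : n%:R * (t / 2) <= `|S| by rewrite ler_normr => /orP[?|?]; [exact: Or41|exact: Or42].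
have D0 : 0 < Num.sqrt Qi * Num.sqrt Qj by rewrite mulr_gt0 ?sqrtr_gt0.
rewrite normrM normfV (gtr0_norm D0) ler_pdivlMr// in tS.
apply: le_trans tS; rewrite mulrCA ler_pM2l//.
have half : n%:R / 2 = Num.sqrt (n%:R / 2) * Num.sqrt (n%:R / 2) :> R.
  by rewrite -expr2 sqr_sqrtr// divr_ge0.
by rewrite half ler_pM ?sqrtr_ge0// ler_sqrt//; lra.
Qed.

End coherence_event.

(** * Sums over disjoint blocks of independent entries *)

Section iid_sums.
Context {R : realType} {d : measure_display} {T : measurableType d}.
Variable P : probability T R.
Variables (I : finType) (U : I -> {RV P >-> R}) (xi : {RV P >-> R}).
Hypothesis indU : mutually_independent P (fun i => U i : T -> R).
Hypothesis lawU : forall i B, measurable B ->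
  P (U i @^-1` B) = P (xi @^-1` B).
Local Open Scope ereal_scope.
Local Notation nu := (distribution P xi).

Lemma iid_pair_rectangle i j A B : i != j -> measurable A -> measurable B ->
  P (U i @^-1` A `&` U j @^-1` B) = nu A * nu B.
Proof.
move=> ij mA mB.
pose C k := if k == i then A else B.
have mC k : measurable (C k) by rewrite /C; case: ifP.
have Ci : C i = A by rewrite /C eqxx.
have Cj : C j = B by rewrite /C eq_sym (negbTE ij).
rewrite -[RHS]/(P (xi @^-1` A) * P (xi @^-1` B)) -(lawU i mA) -(lawU j mB).
transitivity (P (\bigcap_(k in [set` [set i; j]%SET]) U k @^-1` C k)).
  congr (P _); apply/seteqP; split => w.
    by move=> [wA wB] k /=; rewrite !inE => /orP[|] /eqP ->; rewrite /= ?Ci ?Cj.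
  move=> H; split.
    by have := H i; rewrite /= !inE eqxx Ci => /(_ isT).
  by have := H j; rewrite /= !inE eqxx orbT Cj => /(_ isT).
by rewrite indU// finset.big_setU1/= ?inE// finset.big_set1 Ci Cj.
Qed.

Lemma integral_iid i (f : R -> \bar R) :
  measurable_fun [set: R] f -> (forall z, 0 <= f z) ->
  \int[P]_w f (U i w) = \int[P]_w f (xi w).
Proof.
move=> mf f0.
rewrite -[LHS](@ge0_integral_distribution _ _ _ _ _ P (U i) f)//.
rewrite -[RHS](@ge0_integral_distribution _ _ _ _ _ P xi f)//.
by apply: eq_measure_integral => B mB _; exact: lawU.
Qed.

(** Blocks let a summand involve several entries: row [k] contributes two for a product of columns
    and one for a square. *)
Lemma mmt_gen_fun_sum (K : finType) (J : K -> {set I}) (Y : K -> T -> R) t M :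
  (forall k l, k != l -> [disjoint J k & J l]%B) ->
  (forall k, cyl_measurable (fun i => U i : T -> R) (J k) (Y k)) ->
  (forall k, 'M_P (Y k) t = M) ->
  'M_P (fun w => \sum_k Y k w)%R t = M ^+ #|K|.
Proof.
move=> dJ mY MY; rewrite mmt_gen_funE.
under eq_integral do rewrite mulr_sumr expR_sum.
rewrite (@integral_independent_prod _ _ _ P _ _ _ indU _ _ J)//.
- under eq_bigr do rewrite -mmt_gen_funE MY.
  by rewrite big_const; elim: #|K| => // m IH; rewrite iterS IH expeS.
- exact: index_enum_uniq.
- by move=> k l _ _; exact: dJ.
- move=> k; apply: measurableT_comp => //; apply: measurable_funM => //; exact: mY.
Qed.

End iid_sums.

(** * Products of two independent variables with a common law *)

Section product_of_independent.
Context {R : realType} {d : measure_display} {T : measurableType d}.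
Variable P : probability T R.
Variables xi eta : {RV P >-> R}.
Local Open Scope ereal_scope.
Local Notation nu := (distribution P xi).
Hypothesis xi_eta_rectangle : forall A B, measurable A -> measurable B ->
  P (xi @^-1` A `&` eta @^-1` B) = nu A * nu B.

Lemma integral_second_of_pair (f : R -> \bar R) :
  measurable_fun [set: R] f -> (forall z, 0 <= f z) ->
  \int[P]_w f (eta w) = \int[P]_w f (xi w).
Proof.
move=> mf f0.
rewrite -[LHS](@ge0_integral_distribution _ _ _ _ _ P eta f)//.
rewrite -[RHS](@ge0_integral_distribution _ _ _ _ _ P xi f)//.
apply: eq_measure_integral => B mB _.
(* With the whole line as first side, the rectangle formula says that [eta] has law [nu]. *)
have := xi_eta_rectangle measurableT mB.
by rewrite preimage_setT setTI probability_setT mul1e.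
Qed.

Lemma measurable_expR_mul t :
  measurable_fun [set: R * R] (fun z => (expR (t * (z.1 * z.2)))%:E).
Proof.
apply/measurable_EFinP; apply: measurableT_comp => //.
by apply: measurable_funM => //; apply: measurable_funM.
Qed.

Lemma mmt_gen_fun_mulE t :
  'M_P (fun w => xi w * eta w)%R t =
  \int[nu \x nu]_z (expR (t * (z.1 * z.2)))%:E.
Proof.
rewrite mmt_gen_funE -(integral_independent_pair xi_eta_rectangle)//.
exact: measurable_expR_mul.
Qed.

Lemma mmt_gen_fun_mul_le t : (0 <= t)%R ->
  'M_P (fun w => xi w * eta w)%R (- t) <= 'M_P (fun w => xi w * eta w)%R t.
Proof. by move=> t0; rewrite !mmt_gen_fun_mulE; exact: integral_expRN_le. Qed.

Variable c : R.
Hypotheses (c0 : (0 < c)%R) (xi_exp : \int[P]_w (expR (c * xi w ^+ 2))%:E < +oo).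

Let measurable_sq : measurable_fun [set: R] (fun x : R => (expR (c * x ^+ 2))%:E).
Proof.
apply/measurable_EFinP; apply: measurableT_comp => //.
by apply: measurable_funM => //; exact: measurable_funX.
Qed.

Lemma mul_expR_norm_lty : \int[P]_w (expR (c * `|xi w * eta w|))%:E < +oo.
Proof.
apply: (@le_lt_trans _ _
    (\int[P]_w ((expR (c * xi w ^+ 2))%:E + (expR (c * eta w ^+ 2))%:E))).
  apply: ge0_le_integral => //.
  - apply/measurable_EFinP; apply: measurableT_comp => //.
    apply: measurable_funM => //; apply: measurableT_comp => //.
    exact: measurable_funM.
  - by apply: emeasurable_funD; apply: (measurableT_comp measurable_sq).
  - move=> w _; rewrite -EFinD lee_fin.
    exact: expR_mul_norm_le (ltW c0).
rewrite ge0_integralD//; last 2 first.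
- exact: (measurableT_comp measurable_sq).
- exact: (measurableT_comp measurable_sq).
rewrite (integral_second_of_pair (f := fun x => (expR (c * x ^+ 2))%:E))//.
exact: lte_add_pinfty.
Qed.

Lemma expR_norm_lty : \int[P]_w (expR (c * `|xi w|))%:E < +oo.
Proof.
apply: (@le_lt_trans _ _ (\int[P]_w ((expR c)%:E * (expR (c * xi w ^+ 2))%:E))).
  apply: ge0_le_integral => //.
  - apply/measurable_EFinP; apply: measurableT_comp => //.
    by apply: measurable_funM => //; apply: measurableT_comp.
  - by apply: emeasurable_funM => //; apply: (measurableT_comp measurable_sq).
  - by move=> w _; rewrite -EFinM lee_fin; exact: expR_norm_le (ltW c0).
rewrite ge0_integralZl//; last exact: (measurableT_comp measurable_sq).
by rewrite lte_mul_pinfty// lee_fin expR_ge0.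
Qed.

(** Fubini on [nu \x nu], with integrability supplied by the exponential moments; each inner
    integral is a multiple of the mean of [xi]. *)
Lemma integral_mul_mean0 : \int[P]_w (xi w)%:E = 0 ->
  \int[P]_w (xi w * eta w)%:E = 0.
Proof.
move=> xi0.
have mf : measurable_fun [set: R * R] (fun z => (z.1 * z.2)%:E).
  by apply/measurable_EFinP; exact: measurable_funM.
have mZ : measurable_fun setT (fun w => (xi w, eta w)) by exact: measurable_fun_pair.
pose Z : {mfun T >-> (R * R)%type} := mfun_Sub (mem_set mZ).
have mxe : measurable_fun setT (fun w => xi w * eta w)%R by exact: measurable_funM.
have ixi := integrable_of_expR_norm (measurable_funP xi) c0 expR_norm_lty.
have ixe := integrable_of_expR_norm mxe c0 mul_expR_norm_lty.
have /= <- := @integral_distribution _ _ _ _ _ P Z (fun z => (z.1 * z.2)%:E) mf ixe.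
rewrite (eq_measure_integral (nu \x nu)) => [|A mA _]; last first.
  by apply/esym; apply: product_measure_unique => // B C; exact: xi_eta_rectangle.
have iid_nu : nu.-integrable setT (EFin \o id).
  apply/integrableP; split; first exact/measurable_EFinP.
  rewrite (@ge0_integral_distribution _ _ _ _ _ P xi (fun x => `|x%:E|))//.
    by case/integrableP: ixi.
  by apply: measurableT_comp => //; exact/measurable_EFinP.
rewrite -integral12_prod_meas1//=; last first.
  apply/integrableP; split => //.
  rewrite -(integral_independent_pair xi_eta_rectangle)//.
    by case/integrableP: ixe.
  exact: measurableT_comp.
apply: integral0_eq => u _; rewrite /fubini_F/=.
under eq_integral do rewrite EFinM.
rewrite integralZl// (@integral_distribution _ _ _ _ _ P xi (EFin \o id))//=.
  by rewrite xi0 mule0.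
exact/measurable_EFinP.
Qed.

End product_of_independent.

(** * Tail bounds for the columns of a standardized array *)

Section standardized_array.
Context {R : realType} {d : measure_display} {T : measurableType d}.
Variable P : probability T R.
Variables (n p : nat) (U : 'I_n * 'I_p -> {RV P >-> R}) (xi eta : {RV P >-> R}).
Hypothesis n_gt0 : (0 < n)%N.
Hypothesis indU : mutually_independent P (fun ij => U ij : T -> R).
Hypothesis lawU : forall ij B, measurable B ->
  P (U ij @^-1` B) = P (xi @^-1` B).
Local Open Scope ereal_scope.
Local Notation nu := (distribution P xi).
Hypothesis xi_eta_rectangle : forall A B, measurable A -> measurable B ->
  P (xi @^-1` A `&` eta @^-1` B) = nu A * nu B.
Variable c : R.
Hypotheses (c0 : (0 < c)%R) (xi_exp : \int[P]_w (expR (c * xi w ^+ 2))%:E < +oo).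
Hypotheses (xi_mean : \int[P]_w (xi w)%:E = 0)
  (xi_var : \int[P]_w (xi w ^+ 2)%:E = 1).

Local Notation xe := (fun w => xi w * eta w)%R.
Local Notation x2 := (fun w => xi w ^+ 2)%R.
Local Notation I1 := (rate_function P xe).
Local Notation I2 := (rate_function P x2).

Let mxe : measurable_fun setT xe. Proof. exact: measurable_funM. Qed.
Let mx2N : measurable_fun setT (\- x2)%R.
Proof. by apply: measurableT_comp => //; exact: measurable_funX. Qed.

Let x2N_exp : \int[P]_w (expR (c * `|(\- x2)%R w|))%:E < +oo.
Proof.
by under eq_integral do rewrite normrN ger0_norm ?sqr_ge0//.
Qed.

Let x2N_mean : \int[P]_w ((\- x2)%R w)%:E = (- 1)%:E.
Proof.
under eq_integral do rewrite EFinN.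
by rewrite integral_ge0N ?xi_var// => w _; rewrite lee_fin sqr_ge0.
Qed.

Lemma rate_function_mul_gt0 (x : R) : (0 < x)%R -> 0 < I1 x.
Proof.
exact: (rate_function_gt0 mxe c0 (mul_expR_norm_lty xi_eta_rectangle c0 xi_exp)
  (integral_mul_mean0 xi_eta_rectangle c0 xi_exp xi_mean)).
Qed.

(** Here [x] lies below the mean 1 of [xi ^+ 2], so positivity is read off [\- x2], of mean -1, at
    [- x]. *)
Lemma rate_function_sqr_gt0 (x : R) : (x < 1)%R -> 0 < I2 x.
Proof.
move=> x1; rewrite -rate_functionN.
by apply: (rate_function_gt0 mx2N c0 x2N_exp x2N_mean); rewrite ltrN2.
Qed.

Let S i j w := (\sum_k U (k, i) w * U (k, j) w)%R.
Let mS i j : measurable_fun setT (S i j).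
Proof. by apply: measurable_sum => k; exact: measurable_funM. Qed.

(** Distinct rows are disjoint blocks, and [i != j] makes the two entries of a row independent, with
    joint law [nu \x nu] like [(xi, eta)]. *)
Lemma mmt_gen_fun_column_prod i j t : i != j ->
  'M_P (S i j) t = 'M_P xe t ^+ n.
Proof.
move=> ij; rewrite (@mmt_gen_fun_sum _ _ _ P _ U indU 'I_n
  (fun k => [set (k, i); (k, j)]%SET) _ t ('M_P xe t)) ?card_ord//.
- move=> k l kl; rewrite -setI_eq0; apply/eqP/setP => -[a b]; rewrite !inE !xpair_eqE.
  by case: (eqVneq a k) => [->|//]; rewrite (negbTE kl) /= andbF.
- move=> k; apply: measurable_funM.
    by apply: (cyl_measurable_coord (X := fun ij => U ij : T -> R)); rewrite !inE eqxx.
  by apply: (cyl_measurable_coord (X := fun ij => U ij : T -> R)); rewrite !inE eqxx orbT.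
- move=> k; rewrite (mmt_gen_fun_mulE xi_eta_rectangle) mmt_gen_funE.
  have kij : (k, i) != (k, j) by rewrite xpair_eqE eqxx.
  have rect A B (mA : measurable A) (mB : measurable B) :=
    iid_pair_rectangle indU lawU kij mA mB.
  by rewrite -(integral_independent_pair rect (measurable_expR_mul t)).
Qed.

Lemma mmt_gen_fun_column_sq i t : 'M_P (S i i) t = 'M_P x2 t ^+ n.
Proof.
rewrite (@mmt_gen_fun_sum _ _ _ P _ U indU 'I_n
  (fun k => [set (k, i)]%SET) _ t ('M_P x2 t)) ?card_ord//.
- move=> k l kl; rewrite -setI_eq0; apply/eqP/setP => -[a b]; rewrite !inE !xpair_eqE.
  by case: (eqVneq a k) => [->|//]; rewrite (negbTE kl) /= andbF.
- by move=> k; apply: measurable_funM;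
    apply: (cyl_measurable_coord (X := fun ij => U ij : T -> R)); rewrite !inE eqxx.
- move=> k; rewrite !mmt_gen_funE.
  apply: (integral_iid lawU _ (f := fun x => (expR (t * (x * x)))%:E)) => //.
  apply/measurable_EFinP; apply: measurableT_comp => //.
  by apply: measurable_funM => //; exact: measurable_funM.
Qed.

Lemma column_prod_ge i j (x : R) : i != j -> (0 < x)%R ->
  P [set w | (n%:R * x <= S i j w)%R] <= expeR (- (n%:R%:E * I1 x)).
Proof.
move=> ij x0.
apply: (@chernoff_rate_function _ _ _ P (mfun_Sub (mem_set (mS i j))) xe) => //= t t0.
  by rewrite mmt_gen_fun_column_prod.
apply: le_trans (expR_mean_le_mmt_gen_fun mxe c0
  (mul_expR_norm_lty xi_eta_rectangle c0 xi_exp)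
  (integral_mul_mean0 xi_eta_rectangle c0 xi_exp xi_mean) t).
by rewrite lee_fin ler_expR mulr0 nmulr_rle0// ltW.
Qed.

(** The sum [\- S i j] has moment generating function [M(-t) ^ n]; the comparison [M(-t) <= M(t)]
    yields the same rate [I1] as for the upper tail. *)
Lemma column_prod_le i j (x : R) : i != j -> (0 < x)%R ->
  P [set w | (n%:R * x <= - S i j w)%R] <= expeR (- (n%:R%:E * I1 x)).
Proof.
move=> ij x0.
have mSN : measurable_fun setT (\- S i j)%R by exact: measurableT_comp.
apply: (@chernoff_rate_function _ _ _ P (mfun_Sub (mem_set mSN)) xe) => //= t t0.
  rewrite mmt_gen_funN mmt_gen_fun_column_prod//.
  by apply: lee_expe; [exact: mmt_gen_fun_ge0|exact: mmt_gen_fun_mul_le].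
apply: le_trans (expR_mean_le_mmt_gen_fun mxe c0
  (mul_expR_norm_lty xi_eta_rectangle c0 xi_exp)
  (integral_mul_mean0 xi_eta_rectangle c0 xi_exp xi_mean) t).
by rewrite lee_fin ler_expR mulr0 nmulr_rle0// ltW.
Qed.

Lemma column_sq_le i (x : R) : (x < 1)%R ->
  P [set w | (n%:R * - x <= - \sum_k U (k, i) w ^+ 2)%R] <=
  expeR (- (n%:R%:E * I2 x)).
Proof.
move=> x1; rewrite -rate_functionN.
have mSN : measurable_fun setT (\- S i i)%R by exact: measurableT_comp.
apply: (@chernoff_rate_function _ _ _ P (mfun_Sub (mem_set mSN)) (\- x2)%R) => //= t t0.
  by rewrite !mmt_gen_funN mmt_gen_fun_column_sq.
apply: le_trans (expR_mean_le_mmt_gen_fun mx2N c0 x2N_exp x2N_mean t).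
by rewrite lee_fin ler_expR; nra.
Qed.

End standardized_array.

(** * The coherence *)

Lemma content_bigsetU_le (R : realFieldType) (d : measure_display)
    (T : ringOfSetsType d) (mu : {content set T -> \bar R}) (I : Type)
    (s : seq I) (Q : pred I) (A : I -> set T) :
  (forall i, measurable (A i)) ->
  (mu (\big[setU/set0]_(i <- s | Q i) A i) <= \sum_(i <- s | Q i) mu (A i))%E.
Proof.
move=> mA; elim: s => [|i s IH]; first by rewrite !big_nil measure0.
rewrite !big_cons; case: ifP => // _.
by apply: le_trans (measureU2 _ _ _) _ => //; [exact: bigsetU_measurable|exact: leeD2l].
Qed.

Lemma sume_cst (R : realDomainType) (I : finType) (x : \bar R) : (0 <= x ->
  \sum_(i : I) x = #|I|%:R%:E * x)%E.
Proof.
move=> x0; rewrite big_const; elim: #|I| => [|m IH]; first by rewrite mul0e.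
by rewrite iterS IH -natr1 addrC EFinD ge0_muleDl// mul1e.
Qed.

(** * Moments of a standardized variable *)

Section standardization.
Context {R : realType} {d : measure_display} {T : measurableType d}.
Variable P : probability T R.
Variables (x : {RV P >-> R}) (mu sigma t0 : R).
Hypotheses (mean_x : ('E_P[x])%E = mu%:E) (sigma_gt0 : 0 < sigma)
  (var_x : ('V_P[x])%E = (sigma ^+ 2)%:E) (t0_gt0 : 0 < t0)
  (exp_x : ('E_P[fun w => expR (t0 * `|x w| ^+ 2)] < +oo)%E).
Local Open Scope ereal_scope.
Local Notation z := (fun w => (x w - mu) / sigma)%R.

Let sigma_neq0 : sigma != 0%R. Proof. exact: lt0r_neq0. Qed.

Let mz : measurable_fun setT z.
Proof. by apply: measurable_funM => //; exact: measurable_funB. Qed.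

Lemma standardized_sqr_mean : \int[P]_w (z w ^+ 2)%:E = 1.
Proof.
have : \int[P]_w ((x w - mu) ^+ 2)%:E = (sigma ^+ 2)%:E.
  rewrite -var_x /variance covariance.unlock mean_x /= expectation.unlock.
  by apply: eq_integral => w _; rewrite expr2.
under [X in _ -> X = _]eq_integral do rewrite expr_div_n mulrC EFinM.
move=> H; rewrite ge0_integralZl//; last 3 first.
- by apply/measurable_EFinP; apply: measurable_funX; exact: measurable_funB.
- by move=> w _; rewrite lee_fin sqr_ge0.
- by rewrite lee_fin invr_ge0 sqr_ge0.
by rewrite H -EFinM mulVf// expf_neq0.
Qed.

(** The factor 1/2 pays for [(x - mu) ^+ 2 <= 2 * x ^+ 2 + 2 * mu ^+ 2]. *)
Lemma standardized_exp_lty :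
  \int[P]_w (expR (t0 * sigma ^+ 2 / 2 * z w ^+ 2))%:E < +oo.
Proof.
move: exp_x; rewrite expectation.unlock => H.
apply: (@le_lt_trans _ _
    (\int[P]_w ((expR (t0 * mu ^+ 2))%:E * (expR (t0 * `|x w| ^+ 2))%:E))).
  apply: ge0_le_integral => //.
  - apply/measurable_EFinP; apply: measurableT_comp => //.
    by apply: measurable_funM => //; exact: measurable_funX.
  - apply: emeasurable_funM => //; apply/measurable_EFinP; apply: measurableT_comp => //.
    by apply: measurable_funM => //; apply: measurable_funX; exact: measurableT_comp.
  - move=> w _; rewrite -EFinM lee_fin -expRD ler_expR real_normK ?num_real//.
    rewrite [leLHS](_ : _ = t0 * ((x w - mu) ^+ 2 / 2))%R; last by field.
    rewrite -mulrDr ler_pM2l//; have := sqr_ge0 (x w + mu)%R.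
    by rewrite sqrrB sqrrD; lra.
rewrite ge0_integralZl//; last first.
  apply/measurable_EFinP; apply: measurableT_comp => //.
  by apply: measurable_funM => //; apply: measurable_funX; exact: measurableT_comp.
by rewrite lte_mul_pinfty// lee_fin expR_ge0.
Qed.

Lemma standardized_mean : \int[P]_w (z w)%:E = 0.
Proof.
have zc : (0 < t0 * sigma ^+ 2 / 2)%R by rewrite divr_gt0// mulr_gt0// exprn_gt0.
pose Z : {RV P >-> R} := mfun_Sub (mem_set mz).
have iz : P.-integrable setT (EFin \o z).
  exact: (integrable_of_expR_norm mz zc
    (@expR_norm_lty _ _ _ P Z _ zc standardized_exp_lty)).
have ix : \int[P]_w (x w)%:E = mu%:E by rewrite -mean_x expectation.unlock.
have : \int[P]_w (mu + sigma * z w)%:E = mu%:E.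
  rewrite -ix; apply: eq_integral => w _; congr EFin.
  by rewrite mulrC divfK// addrC subrK.
have zE : \int[P]_w (z w)%:E = (fine (\int[P]_w (z w)%:E))%:E.
  by rewrite fineK// integrable_fin_num.
rewrite (integral_affine mz zc (@expR_norm_lty _ _ _ P Z _ zc standardized_exp_lty) zE).
rewrite zE => -[H]; congr EFin; apply: (mulfI sigma_neq0).
by rewrite mulr0; lra.
Qed.

End standardization.

(** Positivity of [t] excludes the starting value 0 of the maximum. *)
Lemma coherence_ge_subset (R : realType) (n p : nat) (A : 'M[R]_(n, p)) mu t :
  0 < t -> t <= coherence_known_mean mu A ->
  exists2 ij : 'I_p * 'I_p, (ij.1 < ij.2)%N & t <= `|rho_tilde mu A ij.1 ij.2|.
Proof. by move=> t0 /bigmax_geP[|//]; rewrite leNgt t0. Qed.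

Lemma measurable_rho_tilde (R : realType) (d : measure_display)
    (T : measurableType d) (n p : nat) (X : 'I_n -> 'I_p -> T -> R) mu i j :
  (forall k l, measurable_fun setT (X k l)) ->
  measurable_fun setT (fun w => rho_tilde mu (\matrix_(k, l) X k l w) i j).
Proof.
move=> mX.
have mC k l : measurable_fun setT (fun w => X k l w - mu) by exact: measurable_funB.
have mN l : measurable_fun setT (fun w => Num.sqrt (\sum_k (X k l w - mu) ^+ 2)).
  under eq_fun do (rewrite -powR12_sqrt; last by apply: sumr_ge0 => k _; exact: sqr_ge0).
  apply: (measurableT_comp (measurable_powR _)).
  by apply: measurable_sum => k; exact: measurable_funX.
rewrite (_ : (fun w => _) = (fun w => (\sum_k (X k i w - mu) * (X k j w - mu)) *
  (Num.sqrt (\sum_k (X k i w - mu) ^+ 2) * Num.sqrt (\sum_k (X k j w - mu) ^+ 2)) `^ (-1))).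
  apply: measurable_funM; first by apply: measurable_sum => k; exact: measurable_funM.
  by apply: (measurableT_comp (measurable_powR _)); exact: measurable_funM.
(* On nonnegative reals the power -1 is the inverse, also at 0, where both are 0. *)
apply/funext => w; rewrite powR_inv1 ?mulr_ge0 ?sqrtr_ge0//.
rewrite (rho_tildeE (u := fun k l => X k l w - mu) _ _ ltr01)// => k l.
by rewrite mxE mul1r.
Qed.

Lemma measurable_coherence_ge (R : realType) (d : measure_display)
    (T : measurableType d) (n p : nat) (X : 'I_n -> 'I_p -> T -> R) mu t :
  0 < t -> (forall k l, measurable_fun setT (X k l)) ->
  measurable [set w | t <= coherence_known_mean mu (\matrix_(k, l) X k l w)].
Proof.
move=> t0 mX.
rewrite (_ : [set _ | _] = \bigcup_(ij in [set ij : 'I_p * 'I_p | (ij.1 < ij.2)%N])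
  [set w | t <= `|rho_tilde mu (\matrix_(k, l) X k l w) ij.1 ij.2|]).
  apply: fin_bigcup_measurable => // ij _.
  rewrite -[X in measurable X]setTI; apply: measurable_fun_le => //.
  by apply: measurableT_comp => //; exact: measurable_rho_tilde.
apply/seteqP; split => w.
  by move=> /(coherence_ge_subset t0)[ij lt_ij h]; exists ij.
by move=> [ij lt_ij h]; apply/bigmax_geP; right; exists ij.
Qed.

(** * Union bound over pairs of columns and single columns *)

Theorem proposition4p1 (R : realType) (d : measure_display)
  (T : measurableType d) (P : probability T R)
  (n p : nat) (hn : (0 < n)%N) (hp : (0 < p)%N)
  (X : 'I_n -> 'I_p -> {RV P >-> R})
  (X_iid : iid P (fun (ij : 'I_n * 'I_p) (w : T) => X ij.1 ij.2 w))
  (x11 : {RV P >-> R}) (x11E : x11 = X (Ordinal hn) (Ordinal hp))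
  (mu sigma t0 : R)
  (mean_x11 : 'E_P[x11]%E = mu%:E)
  (sigma_gt0 : 0 < sigma)
  (var_x11 : 'V_P[x11]%E = (sigma ^+ 2)%:E)
  (t0_gt0 : 0 < t0)
  (exp_moment : ('E_P[fun w => expR (t0 * `|x11 w| ^+ 2)] < +oo)%E)
  (xi eta : {RV P >-> R})
  (xi_eta_iid : iid P
     (tnth [tuple (xi : T -> R); (eta : T -> R);
                  (fun w => (x11 w - mu) / sigma)])) :
  let I1 := rate_function P (fun w => xi w * eta w) in
  let I2 := rate_function P (fun w => xi w ^+ 2) in
  let g := fun t : R => Order.min (I1 (t / 2)) (I2 (1 / 2)) in
  forall t : R, 0 < t ->
    (P [set w | (t <= coherence_known_mean mu (\matrix_(i < n, j < p) X i j w))%R]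
       <= (3 * p%:R ^+ 2)%:E * expeR (- (n%:R%:E * g t)))%E
    /\ (0 < g t)%E.
Proof.
move=> I1 I2 g t t_gt0.
have [indX lawX] := X_iid; have [ind3 law3] := xi_eta_iid.
pose aff (x : R) := (x - mu) / sigma.
have maff : measurable_fun setT aff by apply: measurable_funM => //; exact: measurable_funB.
have mU ij : measurable_fun setT (aff \o X ij.1 ij.2) by exact: measurableT_comp.
pose U (ij : 'I_n * 'I_p) : {RV P >-> R} := mfun_Sub (mem_set (mU ij)).
have maffB B : measurable B -> measurable (aff @^-1` B).
  by move=> mB; rewrite -[_ @^-1` _]setTI; exact: maff.
have indU : mutually_independent P (fun ij => U ij : T -> R).
  by move=> J B mB; apply: (indX J (fun ij => aff @^-1` B ij)) => ij; exact: maffB.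
pose z : {RV P >-> R} := U (Ordinal hn, Ordinal hp).
have zE : (fun w => (x11 w - mu) / sigma) = z by rewrite x11E.
have xi_z B : measurable B -> P (xi @^-1` B) = P (z @^-1` B).
  move=> mB; have := law3 ord0 (lift ord0 (lift ord0 ord0)) B mB.
  by rewrite !(tnth_nth (xi : T -> R))/= zE.
have lawU ij B : measurable B -> P (U ij @^-1` B) = P (xi @^-1` B).
  move=> mB; rewrite xi_z//.
  exact: (lawX ij (Ordinal hn, Ordinal hp) (aff @^-1` B) (maffB _ mB)).
(* The triple is rebundled as random variables so that the rectangle formula for two members of a
   family applies to [xi] and [eta]. *)
pose V (i : 'I_3) : {RV P >-> R} := tnth [tuple xi; eta; z] i.
have VE : (fun i => V i : T -> R) =
    tnth [tuple (xi : T -> R); (eta : T -> R); (z : T -> R)].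
  apply/funext => i; rewrite /V !(tnth_nth xi) !(tnth_nth (xi : T -> R))/=.
  by case: i => -[|[|[|]]].
have indV : mutually_independent P (fun i => V i : T -> R) by rewrite VE -zE.
have lawV i B : measurable B -> P (V i @^-1` B) = P (xi @^-1` B).
  move=> mB; have := law3 i ord0 B mB; rewrite zE -VE => ->.
  by rewrite /V (tnth_nth xi).
have rect A B (mA : measurable A) (mB : measurable B) :
    P (xi @^-1` A `&` eta @^-1` B) = (distribution P xi A * distribution P xi B)%E.
  have := @iid_pair_rectangle _ _ _ _ _ V xi indV lawV ord0 (lift ord0 ord0) A B isT mA mB.
  by rewrite /V !(tnth_nth xi).
pose c := t0 * sigma ^+ 2 / 2.
have c0 : 0 < c by rewrite divr_gt0// mulr_gt0// exprn_gt0.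
have xi2_law (f : R -> \bar R) : measurable_fun [set: R] f -> (forall x, 0 <= f x)%E ->
    (\int[P]_w f (xi w) = \int[P]_w f (aff (x11 w)))%E.
  by move=> mf f0; rewrite -(integral_iid lawU (Ordinal hn, Ordinal hp) mf f0) x11E.
have zexp := standardized_exp_lty mu sigma_gt0 t0_gt0 exp_moment.
have xi_exp : (\int[P]_w (expR (c * xi w ^+ 2))%:E < +oo)%E.
  rewrite (xi2_law (fun x => (expR (c * x ^+ 2))%:E))//.
  apply/measurable_EFinP; apply: measurableT_comp => //.
  by apply: measurable_funM => //; exact: measurable_funX.
have xi_var : (\int[P]_w (xi w ^+ 2)%:E = 1)%E.
  rewrite (xi2_law (fun x => (x ^+ 2)%:E)).
  - exact: standardized_sqr_mean mean_x11 sigma_gt0 var_x11.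
  - by apply/measurable_EFinP; exact: measurable_funX.
  - by move=> x; rewrite lee_fin sqr_ge0.
(* [xi2_law] covers nonnegative integrands only; the signed mean is transferred through the laws,
   using integrability of [xi] and [z]. *)
have xi_mean : (\int[P]_w (xi w)%:E = 0)%E.
  have zmean : (\int[P]_w (z w)%:E = 0)%E.
    by rewrite -zE; exact: standardized_mean mean_x11 sigma_gt0 t0_gt0 exp_moment.
  have ixi := integrable_of_expR_norm (measurable_funP xi) c0 (expR_norm_lty c0 xi_exp).
  have zexp' : (\int[P]_w (expR (c * z w ^+ 2))%:E < +oo)%E.
    by rewrite -zE; exact: zexp.
  have iz := integrable_of_expR_norm (measurable_funP z) c0 (expR_norm_lty c0 zexp').
  have mid : measurable_fun [set: R] (EFin \o id) by exact/measurable_EFinP.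
  rewrite -(@integral_distribution _ _ _ _ _ P z (EFin \o id)) in zmean => //.
  rewrite -(@integral_distribution _ _ _ _ _ P xi (EFin \o id))//.
  rewrite -[RHS]zmean.
  by apply: eq_measure_integral => B mB _; exact: xi_z.
have g_gt0 : (0 < g t)%E.
  rewrite lt_min; apply/andP; split.
    by apply: (rate_function_mul_gt0 rect c0 xi_exp xi_mean); rewrite divr_gt0.
  by apply: (rate_function_sqr_gt0 c0 xi_exp xi_var); lra.
split => //.
set e := expeR (- (n%:R%:E * g t)%E).
have e0 : (0 <= e)%E := expeR_ge0 _.
(* As [g t] is the smaller rate, [e] dominates each single tail bound. *)
have ge_e (I : \bar R) : (g t <= I)%E -> (expeR (- (n%:R%:E * I)) <= e)%E.
  by move=> gI; rewrite lee_expeR leeN2 lee_wpmul2l// lee_fin.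
have gI1 : (g t <= I1 (t / 2)%R)%E by rewrite ge_min lexx.
have gI2 : (g t <= I2 (1 / 2)%R)%E by rewrite ge_min lexx orbT.
pose S i j w := \sum_k U (k, i) w * U (k, j) w.
pose E1 (ij : 'I_p * 'I_p) := [set w | n%:R * (t / 2) <= S ij.1 ij.2 w].
pose E2 (ij : 'I_p * 'I_p) := [set w | n%:R * (t / 2) <= - S ij.1 ij.2 w].
pose E3 i := [set w | n%:R * - (1 / 2) <= - \sum_k U (k, i) w ^+ 2].
have mge (r : R) (f : T -> R) : measurable_fun setT f -> measurable [set w | r <= f w].
  by move=> mf; rewrite -[X in measurable X]setTI; exact: measurable_fun_le.
have mS i j : measurable_fun setT (S i j).
  by apply: measurable_sum => k; exact: measurable_funM.
have mE1 ij : measurable (E1 ij) by exact: mge.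
have mE2 ij : measurable (E2 ij) by apply: mge; exact: measurableT_comp.
have mE3 i : measurable (E3 i).
  apply: mge; apply: measurableT_comp => //.
  by apply: measurable_sum => k; exact: measurable_funX.
(* Norm events are collected per column, not per pair: the total is [2 p ^ 2 + p] copies of [e], at
   most [3 p ^ 2] because [p >= 1]. *)
pose B12 := \big[setU/set0]_(ij : 'I_p * 'I_p | (ij.1 < ij.2)%N) (E1 ij `|` E2 ij).
pose B3 := \big[setU/set0]_(i : 'I_p) E3 i.
have mB12 : measurable B12.
  by apply: bigsetU_measurable => ij _; exact: measurableU.
have mB3 : measurable B3 by exact: bigsetU_measurable.
apply: (@le_trans _ _ (P (B12 `|` B3))).
  apply: le_measure; rewrite ?inE.
  - exact: measurable_coherence_ge (fun k l => measurable_funP (X k l)).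
  - exact: measurableU.
  move=> w /= /(coherence_ge_subset t_gt0)[[i j] /= ij].
  have uE k l : (\matrix_(k, l) X k l w) k l - mu = sigma * U (k, l) w.
    by rewrite mxE mulrC divfK// gt_eqF.
  move=> /(rho_tilde_ge sigma_gt0 t_gt0 uE).
  have inB12 (C : set T) : C w -> C `<=` E1 (i, j) `|` E2 (i, j) -> (B12 `|` B3) w.
    by move=> Cw CE; left; rewrite /B12 (bigD1 (i, j))//=; left; exact: CE.
  have inB3 k : E3 k w -> (B12 `|` B3) w.
    by move=> Ew; right; rewrite /B3 (bigD1 k)//=; left.
  case=> h.
  - by apply: (inB12 (E1 (i, j)) h); exact: subsetUl.
  - by apply: (inB12 (E2 (i, j)) h); exact: subsetUr.
  - exact: inB3 h.
  - exact: inB3 h.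
apply: le_trans (measureU2 _ mB12 mB3) _.
have leB12 : (P B12 <= (p * p)%:R%:E * (e + e))%E.
  apply: le_trans (content_bigsetU_le _ _ _ _) _ => [ij|]; first exact: measurableU.
  have -> : ((p * p)%:R%:E * (e + e) = \sum_(ij : 'I_p * 'I_p) (e + e))%E.
    by rewrite sume_cst ?adde_ge0// card_prod card_ord.
  (* The sum over [i < j] is enlarged to all [p * p] pairs. *)
  rewrite big_mkcond; apply: lee_sum => -[i j] _ /=.
  case: ifPn => [ij|_]; last exact: adde_ge0.
  have neq_ij : i != j by apply: contraTneq ij => ->; rewrite ltnn.
  have t2 : 0 < t / 2 by rewrite divr_gt0.
  apply: le_trans (measureU2 _ (mE1 _) (mE2 _)) _.
  apply: leeD; apply: le_trans (ge_e _ gI1).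
    exact: (column_prod_ge hn indU lawU rect c0 xi_exp xi_mean neq_ij t2).
  exact: (column_prod_le hn indU lawU rect c0 xi_exp xi_mean neq_ij t2).
have leB3 : (P B3 <= p%:R%:E * e)%E.
  apply: le_trans (content_bigsetU_le _ _ _ _) _ => //.
  have -> : (p%:R%:E * e = \sum_(i : 'I_p) e)%E by rewrite sume_cst// card_ord.
  apply: lee_sum => i _; apply: le_trans (ge_e _ gI2).
  by apply: (column_sq_le hn indU lawU c0 xi_exp xi_var); lra.
apply: le_trans (leeD leB12 leB3) _.
rewrite ge0_muleDr// -!ge0_muleDl ?adde_ge0 ?mule_ge0 ?lee_fin// lee_wpmul2r//.
rewrite -!EFinD lee_fin natrM.
have : 1 <= p%:R :> R by rewrite ler1n.
nra.
Qed.
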